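(* Let $t\ge2$ and $K\ge5$ be integers and let $G$ be a connected graph that does not contain a $K$-fat minor model of $U_t$. Then for every vertex $r\in V(G)$, $\mathrm{ipac}(\overrightarrow{G_r})\le (12K+5)t-1$.
   Context: For a connected graph $G$ and $r\in V(G)$, let $\overrightarrow{G_r}$ be the directed graph obtained from $G$ by deleting every edge $xy$ with $\mathrm{dist}(r,x)=\mathrm{dist}(r,y)$ and orienting every remaining edge $xy$ with $\mathrm{dist}(r,x)=\mathrm{dist}(r,y)-1$ from $y$ to $x$. Two vertices are antichain vertices if there is no directed path from one to the other in $\overrightarrow{G_r}$; a set of vertices is an antichain set if any two of its vertices are antichain vertices. $\mathrm{ipac}(\overrightarrow{G_r})$ is the maximum, over all isometric (shortest) paths $P$ of $G$, of the maximum size of an antichain set contained in $V(P)$. $U_t$ is a path on $t$ vertices plus a vertex adjacent to all of them. A $K$-fat minor model of $H$ in $G$ is a collection of connected subgraphs $B_v$ ($v\in V(H)$) and $P_e$ ($e\in E(H)$) with $V(B_v)\cap V(P_e)\ne\emptyset$ whenever $v$ is an end-vertex of $e$, and every other pair of distinct members at distance at least $K$ in $G$. *)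

(* Defs.v *)
From mathcomp Require Import all_boot.
From mathcomp Require Import boolp.

Set Implicit Arguments.
Unset Strict Implicit.
Unset Printing Implicit Defensive.

(* Simple graphs on an arbitrary, possibly infinite, vertex type. *)
Record sgraph (T : Type) := SGraph {
  adj :> rel T;
  adj_sym : symmetric adj;
  adj_irr : irreflexive adj
}.

(* [path e x p] is a walk x :: p; repeated vertices are allowed. *)
Definition linked (T : Type) (e : rel T) (x y : T) : Prop :=
  exists2 p : seq T, path e x p & last x p = y.

Definition connected (T : Type) (G : sgraph T) : Prop :=
  forall x y : T, linked G x y.

Definition walk_of_length (T : Type) (G : sgraph T) (x y : T) (n : nat) : Prop :=
  exists p : seq T, [/\ path G x p, last x p = y & size p = n].

(* The value is 0 when x and y lie in different components; distances are
   meaningful for connected graphs only. *)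
Definition dist (T : Type) (G : sgraph T) (x y : T) : nat :=
  match pselect (exists n, `[< walk_of_length G x y n >]) with
  | left ex_n => ex_minn ex_n
  | right _ => 0
  end.

(* A walk x :: p of length dist x (last x p) has no repeated vertex. *)
Definition isometric_path (T : Type) (G : sgraph T) (x : T) (p : seq T) : Prop :=
  path G x p /\ size p = dist G x (last x p).

(* Arcs y -> x go towards r, so that walks along [arc G r] have strictly
   decreasing distance to r, and are therefore paths. *)
Definition arc (T : Type) (G : sgraph T) (r : T) : rel T :=
  [rel y x | G y x && (dist G r y == (dist G r x).+1)].

Definition antichain_vertices (T : Type) (G : sgraph T) (r x y : T) : Prop :=
  ~ linked (arc G r) x y /\ ~ linked (arc G r) y x.

Definition antichain_set (T : eqType) (G : sgraph T) (r : T) (A : seq T) : Prop :=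
  {in A &, forall x y, x != y -> antichain_vertices G r x y}.

Definition isometric_antichain_size (T : eqType) (G : sgraph T) (r : T)
    (n : nat) : Prop :=
  exists (x : T) (p A : seq T),
    [/\ isometric_path G x p, uniq A, {subset A <= x :: p},
        antichain_set G r A & size A = n].

(* [is_ipac G r m] reads "ipac of G rooted at r is defined and equals m"; in an
   infinite graph the maximum need not exist. *)
Definition is_ipac (T : eqType) (G : sgraph T) (r : T) (m : nat) : Prop :=
  isometric_antichain_size G r m /\
  forall n, isometric_antichain_size G r n -> n <= m.

Record subgraph (T : Type) (G : sgraph T) := Subgraph {
  sub_vertex : pred T;
  sub_adj : sgraph T;
  sub_adj_vertex : forall x y, sub_adj x y -> sub_vertex x;
  sub_adj_adj : forall x y, sub_adj x y -> G x y
}.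

Definition connected_subgraph (T : Type) (G : sgraph T) (S : subgraph G) : Prop :=
  (exists x, sub_vertex S x) /\
  forall x y, sub_vertex S x -> sub_vertex S y -> linked (sub_adj S) x y.

Definition at_distance_geq (T : Type) (G : sgraph T) (K : nat)
    (S1 S2 : subgraph G) : Prop :=
  forall x y, sub_vertex S1 x -> sub_vertex S2 y -> K <= dist G x y.

Definition edges (V : finType) (H : sgraph V) : {set {set V}} :=
  [set [set z.1; z.2] | z : V * V & H z.1 z.2].

(* The values of P outside [edges H] are irrelevant. *)
Record fat_minor_model (K : nat) (V : finType) (H : sgraph V)
    (T : Type) (G : sgraph T)
    (B : V -> subgraph G) (P : {set V} -> subgraph G) : Prop := FatMinorModel {
  fmm_connB : forall v, connected_subgraph (B v);
  fmm_connP : forall e, e \in edges H -> connected_subgraph (P e);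
  fmm_meet : forall e v, e \in edges H -> v \in e ->
    exists x, sub_vertex (B v) x /\ sub_vertex (P e) x;
  fmm_farBB : forall v w, v != w -> at_distance_geq K (B v) (B w);
  fmm_farPP : forall e f, e \in edges H -> f \in edges H -> e != f ->
    at_distance_geq K (P e) (P f);
  fmm_farBP : forall v e, e \in edges H -> v \notin e ->
    at_distance_geq K (B v) (P e)
}.

Definition has_fat_minor_model (K : nat) (V : finType) (H : sgraph V)
    (T : Type) (G : sgraph T) : Prop :=
  exists (B : V -> subgraph G) (P : {set V} -> subgraph G),
    fat_minor_model K H B P.

(* U_t: [Some i] are the path vertices, [None] is the universal vertex. *)
Definition fan_adj (t : nat) : rel (option 'I_t) := fun u v =>
  match u, v with
  | Some i, Some j => (i.+1 == j :> nat) || (j.+1 == i :> nat)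
  | None, None => false
  | _, _ => true
  end.

Lemma fan_adj_sym (t : nat) : symmetric (@fan_adj t).
Proof. by case=> [i|] [j|] //=; rewrite orbC. Qed.

Lemma fan_adj_irr (t : nat) : irreflexive (@fan_adj t).
Proof. by case=> [i|] //=; rewrite orbb gtn_eqF. Qed.

Definition fan (t : nat) : sgraph (option 'I_t) :=
  SGraph (@fan_adj_sym t) (@fan_adj_irr t).

(* Main.v *)
(** Let [h] be the distance to [r] and let [w 0, ..., w n] be an isometric path
    with antichain positions [x 0 < x 1 < ...].  Both [k + h (w k)] and
    [k - h (w k)] are nondecreasing along the path, and each grows by at least
    one between consecutive antichain positions, since otherwise the path would
    descend at full speed from one antichain vertex to the other.  Hence a
    vertex [q] on a shortest path from [w (x i)] to [r] can be at distance less
    than [K] from [w m] only if [x (i - 2K) < m < x (i + 2K)].  For [t] widely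
    spaced indices, follow a shortest path towards [r] until it leaves the
    [K]-neighbourhood of the path for good, last near [w (M i)]; this happens
    because [r] itself cannot be near two distant places of the path.  The apex
    bag is the component of [r] among the vertices at distance at least [K] from
    the path, the other bags are the stretches of radius [2K] around [w (M i)],
    and shortest paths of length at most [K] from [w (M i)] to the apex bag are
    the spokes. *)
Require Import Defs.
From mathcomp Require Import all_boot.
From mathcomp Require Import boolp zify.

Set Implicit Arguments.
Unset Strict Implicit.
Unset Printing Implicit Defensive.

(** * Reachability along a relation *)

Section Linked.
Variables (T : Type) (e : rel T).

Lemma linked_refl x : linked e x x.
Proof. by exists [::]. Qed.

Lemma linked_step x y : e x y -> linked e x y.
Proof. by move=> exy; exists [:: y] => //=; rewrite exy. Qed.

Lemma linked_trans x y z : linked e x y -> linked e y z -> linked e x z.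
Proof.
move=> [p pP py] [q qP qz]; exists (p ++ q); last by rewrite last_cat py.
by rewrite cat_path pP py.
Qed.

Lemma linked_sym x y : symmetric e -> linked e x y -> linked e y x.
Proof.
move=> e_sym [p]; elim: p x => [|z p IHp] x /=; first by move=> _ ->; exact: linked_refl.
case/andP=> exz /IHp IH /IH zy; apply: linked_trans zy _.
by apply: linked_step; rewrite e_sym.
Qed.

Lemma linked_walk (w : nat -> T) a b :
  a <= b -> (forall k, a <= k < b -> e (w k) (w k.+1)) -> linked e (w a) (w b).
Proof.
move=> le_ab; rewrite -(subnKC le_ab); elim: (b - a) => [|d IHd] step.
  by rewrite addn0; exact: linked_refl.
rewrite addnS; apply: (linked_trans (IHd _)).
  by move=> k /andP[ak kd]; apply: step; rewrite ak addnS ltnS ltnW.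
by apply: linked_step; apply: step; rewrite leq_addr addnS ltnSn.
Qed.

End Linked.

(** * Distances and geodesics in a connected graph *)

Section Distance.
Variables (T : Type) (G : sgraph T).
Hypothesis conG : connected G.

(** Connectedness rules out the default branch of [dist], so the distance is attained by a walk. *)
Lemma walk_dist x y : walk_of_length G x y (dist G x y).
Proof.
rewrite /dist; case: pselect => [ex_n|no_n].
  by case: ex_minnP => n /asboolP.
have [p pP py] := conG x y; case: no_n; exists (size p).
by apply/asboolP; exists p.
Qed.

Lemma dist_min x y n : walk_of_length G x y n -> dist G x y <= n.
Proof.
move=> xyn; rewrite /dist; case: pselect => // ex_n.
by case: ex_minnP => m _; apply; apply/asboolP.
Qed.

Lemma distxx x : dist G x x = 0.
Proof. by apply/eqP; rewrite -leqn0; apply: dist_min; exists [::]. Qed.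

Lemma walk_trans x y z m n :
  walk_of_length G x y m -> walk_of_length G y z n ->
  walk_of_length G x z (m + n).
Proof.
move=> [p [pP py <-]] [q [qP qz <-]]; exists (p ++ q).
by rewrite cat_path pP py last_cat py size_cat.
Qed.

Lemma dist_triangle y x z : dist G x z <= dist G x y + dist G y z.
Proof. by apply: dist_min; apply: walk_trans; exact: walk_dist. Qed.

Lemma walk_sym x y n : walk_of_length G x y n -> walk_of_length G y x n.
Proof.
elim: n x => [|n IHn] x [[|z p] [//= pP py]].
  by move=> _; exists [::]; rewrite py.
case=> sz; case/andP: pP => xz pP; rewrite -addn1.
apply: (@walk_trans _ z); first by apply: IHn; exists p.
by exists [:: x]; rewrite /= adj_sym xz.
Qed.

Lemma dist_sym x y : dist G x y = dist G y x.
Proof.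
by apply/eqP; rewrite eqn_leq !dist_min //; apply: walk_sym; exact: walk_dist.
Qed.

Lemma dist1_adj x y : dist G x y = 1 -> G x y.
Proof.
move=> d1; have := walk_dist x y; rewrite d1 => -[[|z [|? ?]] [] //=].
by rewrite andbT => xz <-.
Qed.

(** Indexing by [nat], with values beyond [n] unconstrained, lets positions on the path be compared
    by arithmetic instead of list surgery. *)
Definition geodesic (w : nat -> T) (n : nat) :=
  forall i j, i <= j <= n -> dist G (w i) (w j) = j - i.

Lemma geodesic_adj w n k : geodesic w n -> k < n -> G (w k) (w k.+1).
Proof. by move=> gw kn; apply: dist1_adj; rewrite gw ?subSnn // leqnSn. Qed.

Lemma dist_adj x y : G x y -> dist G x y <= 1.
Proof. by move=> xy; apply: dist_min; exists [:: y]; rewrite /= xy. Qed.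

(** A shortcut between two intermediate vertices would shorten the whole walk, which already
    realises the distance of its ends. *)
Lemma steps_geodesic w n :
  (forall k, k < n -> G (w k) (w k.+1)) -> dist G (w 0) (w n) = n ->
  geodesic w n.
Proof.
move=> step d0n.
have upper i j : i <= j <= n -> dist G (w i) (w j) <= j - i.
  case/andP=> ij; rewrite -(subnKC ij); elim: (j - i) => [|d IHd] dn.
    by rewrite addn0 distxx.
  have := IHd ltac:(lia); have := dist_adj (step (i + d) ltac:(lia)).
  have := dist_triangle (w (i + d)) (w i) (w (i + d.+1)); rewrite addnS; lia.
move=> i j ijn; have := upper i j ijn.
have := upper 0 i ltac:(lia); have := upper j n ltac:(lia).
have := dist_triangle (w i) (w 0) (w n).
have := dist_triangle (w j) (w i) (w n); lia.
Qed.

Lemma path_geodesic x (p : seq T) :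
  isometric_path G x p -> geodesic (nth x (x :: p)) (size p).
Proof.
case=> pP sp; apply: steps_geodesic; first exact: (pathP x pP).
by rewrite -[size p]/(size (x :: p)).-1 nth_last.
Qed.

Lemma geodesic_exists x y :
  exists2 w, w 0 = x /\ w (dist G x y) = y & geodesic w (dist G x y).
Proof.
have [p [pP py sp]] := walk_dist x y.
exists (nth x (x :: p)); last by rewrite -sp; apply: path_geodesic; rewrite /isometric_path py.
by split=> //; rewrite -sp -[size p]/(size (x :: p)).-1 nth_last.
Qed.

(** No order on [i] and [j] is assumed, so two instances bound |i - j| by the distance without a
    case split. *)
Lemma geodesic_le w n i j :
  geodesic w n -> i <= n -> j <= n -> i <= j + dist G (w i) (w j).
Proof.
move=> gw le_in le_jn; case: (leqP i j) => ij; first by lia.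
by rewrite dist_sym gw; lia.
Qed.

(** Along a geodesic from [x] to [y] the distance to [r] drops by at most one per step. Here the
    total drop equals the length, so every step drops by exactly one and is an arc. *)
Lemma linked_arc r x y :
  dist G r x = dist G r y + dist G x y -> linked (Defs.arc G r) x y.
Proof.
have [w [w0 wd] gw] := geodesic_exists x y; move: gw wd.
set d := dist G x y => gw wd rx; rewrite -w0 -wd.
have level k : k <= d -> dist G r (w k) = dist G r y + (d - k).
  move=> kd; have := gw 0 k ltac:(lia); have := gw k d ltac:(lia).
  rewrite w0 wd.
  have := dist_triangle (w k) r x; have := dist_triangle y r (w k).
  rewrite (dist_sym y) (dist_sym (w k) x); lia.
apply: linked_walk => // k kd.
by apply/andP; split; [apply: geodesic_adj gw _; lia|rewrite !level; lia].
Qed.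

End Distance.

(** * Induced subgraphs *)

Section Induced.
Variables (T : Type) (G : sgraph T) (S : T -> Prop).

Definition induced_adj : rel T := fun x y => [&& `[< S x >], `[< S y >] & G x y].

Lemma induced_adj_sym : symmetric induced_adj.
Proof. by move=> x y; rewrite /induced_adj adj_sym andbCA. Qed.

Lemma induced_adj_irr : irreflexive induced_adj.
Proof. by move=> x; rewrite /induced_adj adj_irr !andbF. Qed.

Definition induced : subgraph G.
Proof.
apply: (@Subgraph _ _ (fun x => `[< S x >]) (SGraph induced_adj_sym induced_adj_irr)).
  by move=> x y /= /and3P[].
by move=> x y /= /and3P[].
Defined.

Lemma inducedP x : sub_vertex induced x <-> S x.
Proof. by split=> /asboolP. Qed.

Lemma induced_linked_walk (w : nat -> T) a b :
  a <= b -> (forall k, a <= k < b -> G (w k) (w k.+1)) ->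
  (forall k, a <= k <= b -> S (w k)) -> linked (sub_adj induced) (w a) (w b).
Proof.
move=> ab step inS; apply: linked_walk => // k kab.
by apply/and3P; split; [apply/asboolP/inS; lia|apply/asboolP/inS; lia|exact: step].
Qed.

Lemma induced_connected c :
  S c -> (forall x, S x -> linked (sub_adj induced) c x) ->
  connected_subgraph induced.
Proof.
move=> Sc toc; split; first by exists c; apply/inducedP.
move=> x y /inducedP/toc cx /inducedP/toc cy.
by apply: linked_trans cy; apply: linked_sym cx; exact: induced_adj_sym.
Qed.

End Induced.

(** * Connected pieces: path segments and components *)

Section Segment.
Variables (T : Type) (G : sgraph T).
Hypothesis conG : connected G.

Definition segment (w : nat -> T) (a b : nat) : T -> Prop :=
  fun v => exists2 k, a <= k <= b & w k = v.

Lemma segment_connected w n a b :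
  geodesic G w n -> a <= b <= n -> connected_subgraph (induced G (segment w a b)).
Proof.
move=> gw /andP[ab bn]; apply: (@induced_connected _ _ _ (w a)).
  by exists a => //; lia.
move=> x [k akb <-]; apply: induced_linked_walk; first by lia.
  by move=> i iak; apply: (geodesic_adj conG gw); lia.
by move=> i iak; exists i => //; lia.
Qed.

(** Every vertex of a walk from [c] inside [S] is itself reachable from [c], so the walk survives in
    the subgraph induced on the component. *)
Lemma component_connected (S : T -> Prop) c :
  S c -> connected_subgraph (induced G (linked (sub_adj (induced G S)) c)).
Proof.
move=> Sc; apply: (@induced_connected _ _ _ c); first exact: linked_refl.
move=> x [p]; elim/last_ind: p x => [|p y IHp] x /=.
  by move=> _ <-; exact: linked_refl.
rewrite rcons_path last_rcons => /andP[pP ly] yx.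
have cl : linked (sub_adj (induced G S)) c (last c p) by exists p.
apply: linked_trans (IHp _ pP erefl) _; apply: linked_step.
have /and3P[_ _ Gly] := ly; rewrite -yx.
apply/and3P; split=> //; apply/asboolP => //.
by apply: linked_trans cl _; exact: linked_step.
Qed.

End Segment.

(** * Assembling a fat model of the fan *)

Section FanModel.
Variables (T : Type) (G : sgraph T) (K t n : nat) (r : T).
Variables (w : nat -> T) (M : nat -> nat) (s : nat -> nat -> T) (L : nat -> nat).
Hypothesis conG : connected G.
Hypothesis gw : geodesic G w n.

Definition off_path : T -> Prop := fun v => forall k, k <= n -> K <= dist G v (w k).
Definition apex : T -> Prop := linked (sub_adj (induced G off_path)) r.

Hypothesis r_off : off_path r.
Hypothesis M_inside : forall i, i < t -> 2 * K <= M i /\ M i + 2 * K <= n.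
Hypothesis M_spread : forall i j, i < j -> j < t -> M i + 5 * K <= M j.
Hypothesis gs : forall i, i < t -> geodesic G (s i) (L i).
Hypothesis s_start : forall i, i < t -> s i 0 = w (M i).
Hypothesis s_end : forall i, i < t -> apex (s i (L i)).
Hypothesis L_short : forall i, i < t -> L i <= K.

Definition spoke (i : nat) : T -> Prop := segment (s i) 0 (L i).
(** Vertices of a spoke stay within [K] of [w (M i)], so radius [2 * K] keeps the path outside the
    bag at distance at least [K] from the spoke. Centres [5 * K] apart still leave each link length
    at least [K], which separates consecutive bags. *)
Definition bag (i : nat) : T -> Prop := segment w (M i - 2 * K) (M i + 2 * K).
Definition link (i : nat) : T -> Prop := segment w (M i + 2 * K) (M i.+1 - 2 * K).

Definition far (S1 S2 : T -> Prop) : Prop :=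
  forall u v, S1 u -> S2 v -> K <= dist G u v.

Lemma far_sym S1 S2 : far S1 S2 -> far S2 S1.
Proof. by move=> S12 u v S2u S1v; rewrite dist_sym //; exact: S12. Qed.

Lemma far_induced S1 S2 :
  far S1 S2 -> at_distance_geq K (induced G S1) (induced G S2).
Proof. by move=> S12 u v /inducedP S1u /inducedP S2v; exact: S12. Qed.

Lemma far_segments a b c d : b + K <= c -> d <= n ->
  far (segment w a b) (segment w c d).
Proof.
move=> bc dn u v [i iab <-] [j jcd <-]; rewrite gw; lia.
Qed.

Lemma spoke_near i v : i < t -> spoke i v -> dist G (w (M i)) v <= K.
Proof.
move=> it [k kL <-]; rewrite -s_start // (gs it) ?subn0 //.
by have := L_short it; lia.
Qed.

Lemma far_spoke_segment i a b : i < t -> b <= n ->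
  b + 2 * K <= M i \/ M i + 2 * K <= a -> far (spoke i) (segment w a b).
Proof.
move=> it bn ab u v /(spoke_near it) uM [k kab <-].
have [_ Mn] := M_inside it.
have := geodesic_le conG gw (_ : M i <= n) (_ : k <= n).
have := geodesic_le conG gw (_ : k <= n) (_ : M i <= n).
move=> /(_ ltac:(lia) ltac:(lia)) h1 /(_ ltac:(lia) ltac:(lia)) h2.
have := dist_triangle conG u (w (M i)) (w k).
rewrite (dist_sym conG (w k)) in h1; lia.
Qed.

Lemma far_spokes i j : i < j -> j < t -> far (spoke i) (spoke j).
Proof.
move=> ij jt u v /(spoke_near (ltn_trans ij jt)) uM /(spoke_near jt) vM.
have Mij := M_spread ij jt; have [_ Mn] := M_inside jt.
have := gw (_ : M i <= M j <= n) => /(_ ltac:(lia)).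
have := dist_triangle conG u (w (M i)) (w (M j)).
have := dist_triangle conG v u (w (M j)).
rewrite (dist_sym conG v); lia.
Qed.

(** The empty walk puts [r] in [apex] unconditionally; [r_off] settles that case, and in all others
    the last edge lies in the induced subgraph. *)
Lemma apex_off v : apex v -> off_path v.
Proof.
case=> p; elim/last_ind: p v => [|p y IHp] v /=; first by move=> _ <-.
rewrite rcons_path last_rcons => /andP[_ /and3P[_ /asboolP offy _]] <-.
exact: offy.
Qed.

Lemma far_apex_segment a b : b <= n -> far apex (segment w a b).
Proof.
move=> bn u v /apex_off offu [k kab <-]; apply: offu; lia.
Qed.

Definition fan_bag (v : option 'I_t) : subgraph G :=
  if v is Some i then induced G (bag i) else induced G apex.

(* An edge is labelled by the smaller path vertex it contains. *)
Definition fan_connector (e : {set option 'I_t}) : subgraph G :=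
  if [pick i : 'I_t | (Some i \in e) && [forall j : 'I_t, (Some j \in e) ==> (i <= j)]]
    is Some i then induced G (if None \in e then spoke i else link i)
  else induced G apex.

Lemma fan_connector_spoke (i : 'I_t) :
  fan_connector [set None; Some i] = induced G (spoke i).
Proof.
rewrite /fan_connector; case: pickP => [j|/(_ i)].
  by rewrite !inE /= => /andP[/eqP[->] _].
rewrite !inE eqxx /= => /forallP[] j; apply/implyP.
by rewrite !inE /= => /eqP[->].
Qed.

Lemma fan_connector_link (i j : 'I_t) : i.+1 = j ->
  fan_connector [set Some i; Some j] = induced G (link i).
Proof.
move=> ij; rewrite /fan_connector; case: pickP => [k|/(_ i)].
  rewrite !inE /= => /andP[/orP[] /eqP[->] // /forallP/(_ i)].
  by rewrite !inE eqxx /=; lia.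
rewrite !inE eqxx /= => /forallP[] k; apply/implyP.
by rewrite !inE /= => /orP[] /eqP[->]; lia.
Qed.

Lemma fan_edgesP (e : {set option 'I_t}) : e \in edges (fan t) ->
  (exists i : 'I_t, e = [set None; Some i]) \/
  (exists i j : 'I_t, i.+1 = j /\ e = [set Some i; Some j]).
Proof.
case/imsetP=> -[[i|] [j|]]; rewrite inE //= => ij ->.
- right; case/orP: ij => /eqP ij; first by exists i, j.
  by exists j, i; rewrite setUC.
- by left; exists i; rewrite setUC.
- by left; exists j.
Qed.

Lemma M_mono i j : i <= j -> j < t -> M i <= M j.
Proof.
by rewrite leq_eqVlt => /predU1P[->//|ij] jt; have := M_spread ij jt; lia.
Qed.

Lemma fan_model : has_fat_minor_model K (fan t) G.
Proof.
have linkP (i j : 'I_t) : i.+1 = j -> [/\ i < t, i.+1 < t, M i + 5 * K <= M i.+1 &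
    M i.+1 + 2 * K <= n].
  move=> ij; have it : i.+1 < t by rewrite ij.
  by split=> //; [exact: M_spread|case: (M_inside it)].
exists fan_bag, fan_connector; split.
- case=> [i|] /=.
    have [? ?] := M_inside (ltn_ord i).
    by apply: (segment_connected conG gw); lia.
  exact: component_connected.
- move=> e /fan_edgesP[[i ->]|[i [j [ij ->]]]].
    rewrite fan_connector_spoke.
    by apply: (segment_connected conG (gs (ltn_ord i))); lia.
  have [? ? ? ?] := linkP _ _ ij; rewrite (fan_connector_link ij).
  by apply: (segment_connected conG gw); lia.
(* A spoke meets the apex bag at its end and the path bag at its start; a link shares one end vertex
   with each of its two bags. *)
- move=> e v /fan_edgesP[[i ->]|[i [j [ij ->]]]].
    rewrite fan_connector_spoke !inE => /orP[] /eqP -> /=.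
      exists (s i (L i)); split; apply/asboolP; first exact: s_end (ltn_ord i).
      by exists (L i) => //; lia.
    exists (w (M i)); split; apply/asboolP; first by exists (M i) => //; lia.
    by exists 0 => //; exact: s_start (ltn_ord i).
  have [? ? ? ?] := linkP _ _ ij; rewrite (fan_connector_link ij).
  rewrite !inE => /orP[] /eqP -> /=.
    exists (w (M i + 2 * K)); split; apply/asboolP;
    by exists (M i + 2 * K) => //; lia.
  exists (w (M i.+1 - 2 * K)); split; apply/asboolP;
  by exists (M i.+1 - 2 * K) => //; rewrite -?ij; lia.
- have bags (i j : 'I_t) : i < j -> far (bag i) (bag j).
    move=> ij; have := M_spread ij (ltn_ord j); have [_ ?] := M_inside (ltn_ord j).
    by move=> ?; apply: far_segments; lia.
  have apex_bag (i : 'I_t) : far apex (bag i).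
    by have [_ ?] := M_inside (ltn_ord i); apply: far_apex_segment.
  case=> [i|] [j|] //= ij; apply: far_induced => //; last exact: far_sym.
  case: (ltngtP i j) => [||eq_ij]; [exact: bags| |].
    by move=> ji; apply: far_sym; exact: bags.
  by case/eqP: ij; congr Some; exact: val_inj.
(* Both ends of a link are [2 * K] away from the nearest centres, hence the link is at least that
   far from every centre. *)
- have spoke_link (i i' j : 'I_t) : i.+1 = i' -> far (spoke j) (link i).
    move=> /linkP[? ? ? ?]; apply: far_spoke_segment => //; first by lia.
    case: (leqP j i) => ji; [right|left].
      by have := M_mono ji (ltn_ord i); lia.
    by have := M_mono ji (ltn_ord j); lia.
  have links (i i' j j' : 'I_t) :
      i.+1 = i' -> j.+1 = j' -> i < j -> far (link i) (link j).
    move=> /linkP[? ? ? ?] /linkP[? ? ? ?] ij; apply: far_segments; last by lia.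
    by have := M_mono ij (ltn_ord j); lia.
  move=> e f /fan_edgesP[[i ->]|[i [i' [ii' ->]]]] /fan_edgesP[[j ->]|[j [j' [jj' ->]]]] ef;
  rewrite ?fan_connector_spoke ?(fan_connector_link ii') ?(fan_connector_link jj');
  apply: far_induced.
  + case: (ltngtP i j) => [ij|ji|eq_ij]; [exact: far_spokes| |].
      by apply: far_sym; exact: far_spokes.
    by case/eqP: ef; rewrite (val_inj eq_ij).
  + exact: spoke_link jj'.
  + by apply: far_sym; exact: spoke_link ii'.
  + case: (ltngtP i j) => [ij|ji|eq_ij]; first exact: links ii' jj' ij.
      by apply: far_sym; exact: links jj' ii' ji.
    case/eqP: ef; rewrite (val_inj eq_ij); congr [set _; Some _].
    by apply: val_inj; rewrite /= -ii' -jj' eq_ij.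
- move=> v e /fan_edgesP[[i ->]|[i [i' [ii' ->]]]].
    rewrite fan_connector_spoke !inE; case: v => [j|] //= ji.
    apply: far_induced; apply: far_sym.
    have [_ ?] := M_inside (ltn_ord j); apply: far_spoke_segment => //.
    case: (ltngtP i j) => [/M_spread/(_ (ltn_ord j))|/M_spread/(_ (ltn_ord i))|/val_inj eq_ij].
    + by lia.
    + by lia.
    + by rewrite eq_ij eqxx in ji.
  have [? ? ? ?] := linkP _ _ ii'; rewrite (fan_connector_link ii').
  case: v => [j|] /= nv; apply: far_induced; last by apply: far_apex_segment; lia.
  have [? ?] := M_inside (ltn_ord j).
  move: nv; rewrite !inE negb_or => /andP[/eqP ji /eqP ji'].
  case: (ltngtP j i) => [/M_spread/(_ (ltn_ord i)) ?|ij|/val_inj eq_ij].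
  + by apply: far_segments; lia.
  + have /M_spread/(_ (ltn_ord j)) ? : i.+1 < j.
      rewrite ltn_neqAle ij andbT; apply/eqP => eq_ij; apply: ji'.
      by congr Some; apply: val_inj; rewrite /= -ii' -eq_ij.
    by apply: far_sym; apply: far_segments; lia.
  + by case: ji; rewrite eq_ij.
Qed.

End FanModel.

(** Serves to find where a descent towards [r] is near the path for the last time. *)
Lemma last_such (Q : nat -> Prop) d : Q 0 -> ~ Q d ->
  exists k, [/\ k < d, Q k & forall j, k < j <= d -> ~ Q j].
Proof.
move=> Q0; elim: d => [|d IHd] nQ //.
case: (pselect (Q d)) => [Qd|/IHd [k [kd Qk nQk]]].
  by exists d; split=> // j dj; have -> : j = d.+1 by lia.
exists k; split=> // [|j kj]; first by lia.
by case: (eqVneq j d.+1) => [->//|jd]; apply: nQk; lia.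
Qed.

(** * Antichains along a geodesic *)

Section Antichain.
Variables (T : Type) (G : sgraph T) (r : T) (w : nat -> T) (n N : nat).
Variable (x : nat -> nat).
Hypothesis conG : connected G.
Hypothesis gw : geodesic G w n.
Hypothesis x_lt : forall i j, i < j -> j < N -> x i < x j.
Hypothesis x_le : forall i, i < N -> x i <= n.
Hypothesis anti : forall i j, i < j -> j < N ->
  antichain_vertices G r (w (x i)) (w (x j)).

(* Both inequalities are kept free of truncated subtraction of heights: the
   second says that [x - dist r (w x)] grows by at least [j - i]. *)
Lemma antichain_growth i j : i <= j -> j < N ->
  dist G r (w (x i)) + x i + (j - i) <= dist G r (w (x j)) + x j /\
  dist G r (w (x j)) + x i + (j - i) <= dist G r (w (x i)) + x j.
Proof.
move=> ij; rewrite -(subnKC ij); elim: (j - i) => [|d IHd] dN.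
  by rewrite addn0; lia.
rewrite addnS in dN *; have := IHd ltac:(lia).
have lt_d : i + d < (i + d).+1 by [].
have := x_lt lt_d dN; have := x_le dN; have [no_down no_up] := anti lt_d dN.
set a := x (i + d) in no_down no_up *; set b := x (i + d).+1 in no_down no_up *.
move=> bn ab; have dab := gw (_ : a <= b <= n); have := dab ltac:(lia) => {}dab.
have := dist_triangle conG (w a) r (w b); have := dist_triangle conG (w b) r (w a).
have dba : dist G (w b) (w a) = b - a by rewrite dist_sym.
(* Heights differ by at most [b - a]; excluding directed paths both ways makes both bounds
   strict. *)
have /eqP : dist G r (w a) <> dist G r (w b) + dist G (w a) (w b).
  by move/(linked_arc conG).
have /eqP : dist G r (w b) <> dist G r (w a) + dist G (w b) (w a).
  by move/(linked_arc conG).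
rewrite dab dba; lia.
Qed.

(** Write h for the distance to [r]. Triangle inequalities through [q] give |m - x i| < h (w (x i))
    - h (w m) + 2K. For [m] after [x i] this says that k + h (w k) has grown by less than 2K, so [m]
    cannot reach [x (i + 2 * K)]; for [m] before [x i], k - h (w k) gives the mirror bound. *)
Lemma descent_near K i q m : i < N -> m <= n ->
  dist G r (w (x i)) = dist G r q + dist G (w (x i)) q -> dist G q (w m) < K ->
  (i + 2 * K < N -> m < x (i + 2 * K)) /\ (2 * K <= i -> x (i - 2 * K) < m).
Proof.
move=> iN mn dq qm; have xin := x_le iN.
have := dist_triangle conG q (w (x i)) (w m); set D := dist G (w (x i)) (w m) => DD.
have := dist_triangle conG q r (w m).
have := dist_triangle conG (w m) r q; rewrite (dist_sym conG (w m)) => h1 h2.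
have g1 := geodesic_le conG gw xin mn; have g2 := geodesic_le conG gw mn xin.
rewrite (dist_sym conG (w m)) -/D in g1 g2.
split=> Ki; rewrite ltnNge; apply/negP => le_m.
  have [up _] := antichain_growth (leq_addr (2 * K) i) Ki.
  have xKn := x_le Ki; have dm := gw (_ : x (i + 2 * K) <= m <= n).
  have := dm ltac:(lia); have := dist_triangle conG (w m) r (w (x (i + 2 * K))).
  by rewrite (dist_sym conG (w m)); lia.
have [_ dn] := antichain_growth (leq_subr (2 * K) i) iN.
have xKn := x_le (leq_ltn_trans (leq_subr (2 * K) i) iN).
have dm := gw (_ : m <= x (i - 2 * K) <= n).
have := dm ltac:(lia); have := dist_triangle conG (w m) r (w (x (i - 2 * K))).
lia.
Qed.

End Antichain.

(** * From a long antichain to a fan model *)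

Lemma antichain_positions (T : eqType) (G : sgraph T) (r x : T) (p A : seq T) :
  connected G -> isometric_path G x p -> uniq A -> {subset A <= x :: p} ->
  antichain_set G r A ->
  exists f : nat -> nat,
    [/\ forall i j, i < j -> j < size A -> f i < f j,
        forall i, i < size A -> f i <= size p &
        forall i j, i < j -> j < size A -> antichain_vertices G r
          (nth x (x :: p) (f i)) (nth x (x :: p) (f j))].
Proof.
move=> conG iso uA sA anti; have gw := path_geodesic conG iso.
set w := nth x (x :: p) in gw *.
have w_inj i j : i <= size p -> j <= size p -> w i = w j -> i = j.
  move=> iN jN eq_w; have := geodesic_le conG gw iN jN.
  by have := geodesic_le conG gw jN iN; rewrite eq_w distxx; lia.
(* Filtering the indices sorts the antichain in path order; injectivity of the geodesic makes this
   list exactly as long as [A]. *)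
set s := [seq k <- iota 0 (size p).+1 | w k \in A].
have sw : perm_eq (map w s) A.
  apply: uniq_perm => // [|v].
    rewrite map_inj_in_uniq; first by rewrite filter_uniq ?iota_uniq.
    by move=> i j; rewrite !mem_filter !mem_iota => /andP[_ ?] /andP[_ ?]; apply: w_inj; lia.
  apply/mapP/idP => [[k]|vA]; first by rewrite mem_filter => /andP[wA _] ->.
  have vp := sA v vA; exists (index v (x :: p)); last by rewrite /w nth_index.
  by rewrite mem_filter /w nth_index // vA mem_iota /= add0n; rewrite -index_mem in vp.
have sz : size s = size A by rewrite -(perm_size sw) size_map.
have s_in i : i < size A -> (w (nth 0 s i) \in A) && (nth 0 s i <= size p).
  rewrite -sz => /(mem_nth 0); rewrite mem_filter mem_iota => /andP[-> /=]; lia.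
have s_lt i j : i < j -> j < size A -> nth 0 s i < nth 0 s j.
  move=> ij; rewrite -sz => js; have : sorted ltn s.
    by apply: sorted_filter; [exact: ltn_trans|exact: iota_ltn_sorted].
  by move/(sorted_ltn_nth ltn_trans 0); apply => //; rewrite inE; lia.
exists (nth 0 s); split=> // [i /s_in/andP[]//|i j ij jA].
have /andP[jin js] := s_in _ jA; have /andP[iin is_] := s_in _ (ltn_trans ij jA).
apply: anti => //; apply/eqP => /(w_inj _ _ is_ js) eq_s.
by have := s_lt _ _ ij jA; rewrite eq_s ltnn.
Qed.

Lemma long_antichain_fan_model (t K : nat) (T : eqType) (G : sgraph T) (r : T)
    (N : nat) : 2 <= t -> 0 < K -> connected G ->
  isometric_antichain_size G r N -> (12 * K + 5) * t <= N ->
  has_fat_minor_model K (fan t) G.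
Proof.
move=> t2 K0 conG [x [p [A [iso uA sA anti <-]]]] tN.
have gw := path_geodesic conG iso.
have [f [f_lt f_le f_anti]] := antichain_positions conG iso uA sA anti.
move: gw f_anti; set w := nth x (x :: p); set n := size p in f_le * => gw f_anti.
have near := descent_near conG gw f_lt f_le f_anti.
have f_grow i j : i <= j -> j < size A -> f i + (j - i) <= f j.
  move=> ij; rewrite -(subnKC ij); elim: (j - i) => [|d IHd] dA; first by rewrite addn0; lia.
  have := f_lt (i + d) (i + d.+1) ltac:(lia) dA; have := IHd ltac:(lia); lia.
(* The antichain is cut into [t] blocks of [12 * K + 5] positions with [c i] near the middle of
   block [i]. As [M i] will lie between [f (c i - 2 * K)] and [f (c i + 2 * K)], distinct [M i] are
   more than [8 * K] apart, and at least [4 * K] positions remain on either side for the bags. *)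
pose c i := (12 * K + 5) * i + 6 * K.
have c_lt i : i < t -> c i + 6 * K < size A.
  move=> it; apply: leq_trans tN; rewrite /c.
  have : (12 * K + 5) * i.+1 <= (12 * K + 5) * t by rewrite leq_mul2l it orbT.
  by rewrite mulnS; lia.
have c_step i j : i < j -> c i + (12 * K + 5) <= c j.
  move=> ij; rewrite /c.
  have : (12 * K + 5) * i.+1 <= (12 * K + 5) * j by rewrite leq_mul2l ij orbT.
  by rewrite mulnS; lia.
have c_near i q m : i < t -> m <= n ->
    dist G r (w (f (c i))) = dist G r q + dist G (w (f (c i))) q ->
    dist G q (w m) < K -> f (c i - 2 * K) < m < f (c i + 2 * K).
  move=> it mn dq qm; have cA := c_lt i it.
  have [hi lo] := near K (c i) q m ltac:(lia) mn dq qm.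
  by apply/andP; split; [apply: lo; rewrite /c|apply: hi]; lia.
(* The root ends every descent, so a path vertex near it would lie in the disjoint windows around
   [c 0] and [c 1]; the second one exists because [2 <= t]. *)
have r_off : off_path G K n w r.
  move=> m mn; rewrite leqNgt; apply/negP => rm.
  have t0 : 0 < t by lia.
  have on_r i : dist G r (w (f (c i))) = dist G r r + dist G (w (f (c i))) r.
    by rewrite distxx // dist_sym.
  have /andP[_ hi] := c_near 0 r m t0 mn (on_r 0) rm.
  have /andP[lo _] := c_near 1 r m t2 mn (on_r 1) rm.
  have := f_grow (c 0 + 2 * K) (c 1 - 2 * K).
  have := c_step 0 1 isT; have := c_lt 1 t2; lia.
(* The bound [i < t] sits under the existential so that [choice] yields functions on all of [nat];
   the pair [(0, r)] is a dummy value. *)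
have leave i : exists mz : nat * T, i < t ->
    [/\ f (c i - 2 * K) < mz.1 < f (c i + 2 * K), dist G (w mz.1) mz.2 <= K &
        apex G K n r w mz.2].
  case: (ltnP i t) => [it|ti]; last by exists (0, r).
  have [u [u0 ud] gu] := geodesic_exists conG (w (f (c i))) r.
  move: gu ud; set d := dist G _ r => gu ud.
  pose close k := exists2 m, m <= n & dist G (u k) (w m) < K.
  have [||k [kd [m mn ukm] after]] := @last_such close d.
  - exists (f (c i)); last by rewrite u0 distxx.
    by apply: f_le; have := c_lt i it; lia.
  - by case=> m mn; rewrite ud ltnNge r_off.
  have off j : k < j <= d -> off_path G K n w (u j).
    by move=> /after nc m' m'n; rewrite leqNgt; apply/negP => um; apply: nc; exists m'.
  exists (m, u k.+1) => _; split=> /=.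
  - apply: c_near ukm => //; rewrite -{2}u0.
    have := gu 0 k ltac:(lia); have := gu k d ltac:(lia).
    rewrite ud (dist_sym conG (u k)) => -> ->.
    by rewrite dist_sym // -/d; lia.
  (* Closeness at [k] is strict, so one more step costs at most [K] in total. *)
  - have := dist_triangle conG (u k) (w m) (u k.+1).
    by rewrite (gu k k.+1) 1?(dist_sym conG (w m) (u k)); lia.
  (* After its last close vertex the descent stays off the path, so its remainder joins [u k.+1] to
     [r] inside [off_path]. *)
  - rewrite /apex -ud; apply: linked_sym; first exact: induced_adj_sym.
    apply: induced_linked_walk => // j jk.
    by apply: (geodesic_adj conG gu); lia.
have [mz mzP] := choice leave.
pose M i := (mz i).1; pose z i := (mz i).2.
have spokes i : exists g : nat -> T, [/\ g 0 = w (M i), g (dist G (w (M i)) (z i)) = z i &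
    geodesic G g (dist G (w (M i)) (z i))].
  by have [g [g0 gd] gg] := geodesic_exists conG (w (M i)) (z i); exists g.
have [s sP] := choice spokes.
apply: (@fan_model _ G K t n r w M s (fun i => dist G (w (M i)) (z i))) => //.
- move=> i it; have [/andP[lo hi] _ _] := mzP i it; have cA := c_lt i it.
  have := f_grow 0 (c i - 2 * K) ltac:(lia) ltac:(lia).
  have := f_grow (c i + 2 * K) (c i + 4 * K) ltac:(lia) ltac:(lia).
  have := f_le (c i + 4 * K) ltac:(lia).
  rewrite -/(M i) in lo hi; rewrite /c in lo hi *; lia.
- move=> i j ij jt; have [/andP[_ hi] _ _] := mzP i (ltn_trans ij jt).
  have [/andP[lo _] _ _] := mzP j jt; have cA := c_lt j jt; have cij := c_step i j ij.
  have := f_grow (c i + 2 * K) (c j - 2 * K) ltac:(lia) ltac:(lia).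
  rewrite -/(M i) -/(M j) in lo hi *; lia.
- by move=> i _; case: (sP i).
- by move=> i _; case: (sP i).
- by move=> i it; case: (sP i) => _ -> _; case: (mzP i it).
- by move=> i it; case: (mzP i it).
Qed.

Theorem theorem3p1 (t K : nat) (ht : 2 <= t) (hK : 5 <= K)
    (T : eqType) (G : sgraph T) (hG : connected G)
    (hU : ~ has_fat_minor_model K (fan t) G) (r : T) :
  exists2 m : nat, is_ipac G r m & m <= (12 * K + 5) * t - 1.
Proof.
have bound n : isometric_antichain_size G r n -> n <= (12 * K + 5) * t - 1.
  move=> size_n; rewrite leqNgt; apply/negP => lt_n; apply: hU.
  by apply: (@long_antichain_fan_model _ _ _ _ r n) => //; lia.
(* The graph may be infinite, so the maximum is obtained from the uniform bound together with the
   empty antichain on a one-vertex path. *)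
have ex_n : exists n, `[< isometric_antichain_size G r n >].
  exists 0; apply/asboolP; exists r, [::], [::]; split=> //.
  by split=> //=; rewrite distxx.
have ub n : `[< isometric_antichain_size G r n >] -> n <= (12 * K + 5) * t - 1.
  by move/asboolP/bound.
case: (ex_maxnP ex_n ub) => m /asboolP size_m max_m.
by exists m; [split=> // n /asboolP/max_m|exact: bound].
Qed.
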